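(* For integers $k, n \geq 0$ let $S(k,n)$ be the maximum cardinality of a locally $k$-wide family of segments of $[n]$. Then $S$ satisfies the recursive equations $$S(k,0) = 1 \ (k \geq 0), \qquad S(0,n) = 1 \ (n \geq 0), \qquad S(k,1) = 2 \ \text{ for } k \geq 1,$$ $$S(k,n) = 2n - 1 + S(k-1, n-2) \ \text{ for } k \geq 1 \text{ and } n \geq 2.$$
   Context: $[n] = \{1,2,\dots,n\}$ (so $[0]=\emptyset$). A segment of $[n]$ is a subset of the form $[i,j] = \{m \in \mathbf{Z} \mid i \leq m \leq j\} \subseteq [n]$; the empty set is a segment. A family $\mathcal{F}$ of subsets of a finite set $X$ is locally $k$-wide iff for every $x \in X$ every antichain (with respect to inclusion) of $\{U \in \mathcal{F} \mid x \in U\}$ has at most $k$ members. *)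

(* Defs.v *)
From mathcomp Require Import all_boot.

Set Implicit Arguments.
Unset Strict Implicit.
Unset Printing Implicit Defensive.

Definition antichain (T : finType) (A : {set {set T}}) : bool :=
  [forall U in A, forall V in A, (U \subset V) ==> (U == V)].

Definition locally_wide (T : finType) (k : nat) (F : {set {set T}}) : bool :=
  [forall x : T, forall A : {set {set T}},
     (A \subset [set U in F | x \in U]) && antichain A ==> (#|A| <= k)].

(* The set [n] = {1, ..., n} is encoded as 'I_n, with m : 'I_n standing for
   the integer m.+1. *)
Definition segment (n i j : nat) : {set 'I_n} :=
  [set m : 'I_n | i <= m.+1 <= j].

(* Endpoints 0 <= i <= n + 1 and 0 <= j <= n suffice to get every segment,
   including the empty one (i = n + 1); see segmentsP. *)
Definition segments (n : nat) : {set {set 'I_n}} :=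
  [set segment n i j | i : 'I_n.+2, j : 'I_n.+1].

Lemma segmentsP (n : nat) (U : {set 'I_n}) :
  reflect (exists i j : nat, U = segment n i j) (U \in segments n).
Proof.
apply: (iffP imset2P) => [[i j _ _ ->]|[i [j ->]]]; first by exists i, j.
exists (inord (minn i n.+1)) (inord (minn j n)) => //.
apply/setP=> m; rewrite !inE !inordK ?ltnS ?geq_minr //.
rewrite geq_min leq_min (ltn_ord m) andbT.
by rewrite [n < m.+1]ltnNge (ltn_ord m) orbF.
Qed.

Definition max_wide (k n : nat) : nat :=
  \max_(F : {set {set 'I_n}} | (F \subset segments n) && locally_wide k F) #|F|.

(* The empty family is admissible, so the maximum is not over an empty range. *)
Lemma max_wideP (k n : nat) :
  (exists F : {set {set 'I_n}},
     [/\ F \subset segments n, locally_wide k F & #|F| = max_wide k n]) /\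
  (forall F : {set {set 'I_n}},
     F \subset segments n -> locally_wide k F -> #|F| <= max_wide k n).
Proof.
pose P (F : {set {set 'I_n}}) := (F \subset segments n) && locally_wide k F.
split=> [|F sF wF]; last by apply: leq_bigmax_cond; rewrite sF.
have P0 : P set0.
  rewrite /P sub0set; apply/forallP=> x; apply/forallP=> A; apply/implyP.
  case/andP=> /subsetP sA _; rewrite (_ : A = set0) ?cards0 //.
  by apply/setP=> U; rewrite inE; apply/negP => /sA; rewrite !inE.
have /(eq_bigmax_cond (fun F : {set {set 'I_n}} => #|F|)) [F /andP[sF wF] eF] :
  0 < #|P| by apply/card_gt0P; exists set0.
by exists F; split; rewrite // -eF.
Qed.

(* Main.v *)
(* Write a segment [a, b] as the point (a, b); an antichain of segments with a
   common element is a chain of points increasing in both coordinates whose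
   last left end is at most its first right end.  We show that
   S(k, n) = 1 + C(n+1, 2) - C(n-2k+1, 2), which satisfies the recursion.

   Lower bound: take the segments that have at most k elements or start in
   {1, ..., k}.  An antichain through x injects into each of its members.

   Upper bound: say that (c, d) crosses (a, b) if c < a <= d < b.  Given a
   family E on m consecutive integers, keep (a, b) if some (c, d) in E crosses
   it with d >= b', where (a, b') is the previous point of E in row a.  At most
   2m - 1 points are not kept: at most one per row has no previous point, and
   otherwise (a, b') is the first point of E in column b'.  Send a kept (a, b)
   to (a, d) with d maximal such that some (c, d) in E crosses (a, b).  This is
   injective, its image lives on m - 2 integers, and a chain of the image gives
   rise to a chain of E with one more point. *)
Require Import Defs.
From mathcomp Require Import all_boot zify.

Set Implicit Arguments.
Unset Strict Implicit.
Unset Printing Implicit Defensive.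

(** * Counting tools *)

Lemma leq_card_interval (T : finType) (A : {set T}) (f : T -> nat) (lo m : nat) :
  {in A &, injective f} -> {in A, forall x, lo <= f x < lo + m} -> #|A| <= m.
Proof.
move=> injf rngf; rewrite cardE -(size_map f) -[m in leqRHS](size_iota lo).
apply: uniq_leq_size => [|_ /mapP[x Ax ->]].
  by rewrite map_inj_in_uniq ?enum_uniq // => x y; rewrite !mem_enum; apply: injf.
by rewrite mem_iota rngf // -mem_enum.
Qed.

(** A sigma type, so that [sval] yields a function; [x0] is the default value when nothing satisfies
    [P]. *)
Lemma pick_max (T : finType) (P : pred T) (f : T -> nat) (x0 : T) :
  {y : T | (exists x, P x) -> P y /\ forall x, P x -> f x <= f y}.
Proof.
case: (pickP P) => [x Px|P0]; last by exists x0 => -[x]; rewrite P0.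
by case: (arg_maxnP f Px) => y Py maxy; exists y.
Qed.

Lemma bin2_rec m : 'C(m.+1, 2) = 2 * m - 1 + 'C((m - 2).+1, 2).
Proof.
case: m => [|[|m]] //; have -> : m.+2 - 2 = m by lia.
rewrite (binS m.+2) (binS m.+1) !bin1; lia.
Qed.

(** * Upper bound for families of points, by peeling *)

Section Chains.
Variable N : nat.
Implicit Types (p q r : 'I_N * 'I_N) (s t : seq ('I_N * 'I_N)).
Implicit Types E : {set 'I_N * 'I_N}.

Definition below p q := (p.1 < q.1) && (p.2 < q.2).

(** The chain [p :: s] has one point more than [s], so at most [k] points are allowed. *)
Definition chain_free (k : nat) E := forall p s,
  path below p s -> {subset p :: s <= E} -> (last p s).1 <= p.2 -> size s < k.

Lemma below_trans : transitive below.
Proof. by move=> q p r; rewrite /below; lia. Qed.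

Lemma path_below_uniq p s : path below p s -> uniq (p :: s).
Proof.
by apply: (sorted_uniq below_trans _ (s := p :: s)) => q; rewrite /below ltnn.
Qed.

Lemma path_below_last p s q : path below p s -> q \in p :: s ->
  [/\ p.2 <= q.2, p.1 <= q.1 & q.1 <= (last p s).1].
Proof.
elim: s p q => [|r s IHs] p q /=; first by move=> _; rewrite inE => /eqP ->.
case/andP=> /andP[pr1 pr2] rs; rewrite inE => /predU1P[->|qs].
  by have [] := IHs r r rs (mem_head _ _); split => //; lia.
by have [] := IHs r q rs qs; split; lia.
Qed.

Lemma path_below_antichain p s q r : path below p s ->
  q \in p :: s -> r \in p :: s -> r.1 <= q.1 -> q.2 <= r.2 -> q = r.
Proof.
elim: s p => [|p' s IHs] p; first by rewrite !inE => _ /eqP -> /eqP ->.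
move=> ps; have ps' : path below p' s by case/andP: ps.
have min := allP (order_path_min below_trans ps).
rewrite inE => /predU1P[->|qs]; rewrite inE => /predU1P[->|rs] //.
- by move/min: rs => /andP[]; lia.
- by move/min: qs => /andP[]; lia.
exact: IHs ps' qs rs.
Qed.

Section Peel.
Variables (E : {set 'I_N * 'I_N}) (lo m : nat).
Hypothesis rangeE : {in E, forall p, lo <= p.1 <= p.2 /\ p.2 < lo + m}.

Definition crosses p : pred ('I_N * 'I_N) :=
  fun q => [&& q \in E, q.1 < p.1, p.1 <= q.2 & q.2 < p.2].

Definition precedes p : pred ('I_N * 'I_N) :=
  fun q => [&& q \in E, q.1 == p.1 & q.2 < p.2].

(** Quantifying over all preceding points covers the first point of a row without a special case. *)
Definition kept : {set 'I_N * 'I_N} :=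
  [set p in E | [exists q, crosses p q && [forall r, precedes p r ==> (r.2 <= q.2)]]].

Definition top_cross p := sval (pick_max (crosses p) (fun q => q.2) p).

Definition prev p := sval (pick_max (precedes p) (fun q => q.2) p).

Lemma top_crossP p : p \in kept ->
  crosses p (top_cross p) /\ forall q, crosses p q -> q.2 <= (top_cross p).2.
Proof.
rewrite inE => /andP[_ /existsP[q /andP[pq _]]].
by rewrite /top_cross; case: pick_max => /= y; apply; exists q.
Qed.

Lemma prevP p r : precedes p r ->
  precedes p (prev p) /\ forall q, precedes p q -> q.2 <= (prev p).2.
Proof. by rewrite /prev; case: pick_max => /= y yP pr; apply: yP; exists r. Qed.

Lemma kept_precedes p r : p \in kept -> precedes p r -> r.2 <= (top_cross p).2.
Proof.
move=> Kp pr; have [_ max] := top_crossP Kp.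
move: Kp; rewrite inE => /andP[_ /existsP[q /andP[/max le_q /forallP/(_ r)]]].
by rewrite pr => /leq_trans; apply.
Qed.

Definition shrink p := (p.1, (top_cross p).2).

Lemma same_rowP p q : p.1 = q.1 -> p \in E -> q \in E ->
  [\/ p = q, precedes q p | precedes p q].
Proof.
case: p q => [a b] [c d] /= <- Ep Eq; rewrite /precedes /= Ep Eq eqxx /=.
by case: (ltngtP b d) => [||/val_inj ->]; [constructor 2|constructor 3|constructor 1].
Qed.

(** If [p] precedes [q] in a row, then [top_cross p] ends before [p], and [p] ends no later than
    [top_cross q]. *)
Lemma shrink_inj : {in kept &, injective shrink}.
Proof.
move=> p q Kp Kq [eq1 eq2]; have eq2n := congr1 val eq2.
have [Ep Eq] : p \in E /\ q \in E by move: Kp Kq; rewrite !inE => /andP[-> _] /andP[-> _].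
have [/and4P[_ _ _ ltp] _] := top_crossP Kp.
have [/and4P[_ _ _ ltq] _] := top_crossP Kq.
have [//|/(kept_precedes Kq)|/(kept_precedes Kp)] := same_rowP eq1 Ep Eq.
  by move: eq2n ltp => /= ->; lia.
by move: eq2n ltq => /= ->; lia.
Qed.

Lemma shrink_range :
  {in shrink @: kept, forall p, lo.+1 <= p.1 <= p.2 /\ p.2 < lo.+1 + (m - 2)}.
Proof.
move=> _ /imsetP[p Kp ->] /=; have [/and4P[Et lt1 le2 lt2] _] := top_crossP Kp.
have Ep : p \in E by move: Kp; rewrite inE => /andP[].
by have [] := rangeE Et; have [] := rangeE Ep; split; lia.
Qed.

Lemma card_removed : #|E :\: kept| <= 2 * m - 1.
Proof.
pose P := [set p | [exists r, precedes p r]].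
have RE p : p \in E :\: kept -> p \in E by case/setDP.
rewrite -(cardsID P) addnC (_ : 2 * m - 1 = m + (m - 1)); last by lia.
apply: leq_add.
  apply: (@leq_card_interval _ _ (fun p => p.1) lo) => [p q|p].
    move=> /setDP[/RE Ep nPp] /setDP[/RE Eq nPq] /val_inj eq1.
    have [//|qp|pq] := same_rowP eq1 Ep Eq.
      by case/negP: nPq; rewrite inE; apply/existsP; exists p.
    by case/negP: nPp; rewrite inE; apply/existsP; exists q.
  by case/setDP=> /RE/rangeE; lia.
have prevPP p : p \in (E :\: kept) :&: P ->
  precedes p (prev p) /\ forall q, precedes p q -> q.2 <= (prev p).2.
  by case/setIP=> _; rewrite inE => /existsP[r /prevP].
(* Only [m - 1] values occur: [prev p] ends before [p], so never at the last integer. *)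
apply: (@leq_card_interval _ _ (fun p => (prev p).2) lo) => [p q Hp Hq eq2|p Hp].
  (* Otherwise [prev p'] would cross [q'] and end where [prev q'] does, so [q'] would be kept. *)
  have no_lt p' q' : p' \in (E :\: kept) :&: P -> q' \in (E :\: kept) :&: P ->
      val (prev p').2 = val (prev q').2 -> ~ p'.1 < q'.1.
    move=> Hp' Hq' /= eq2' lt1.
    have [/and3P[Ep' /eqP r1 r2] _] := prevPP _ Hp'.
    have [/and3P[Eq' /eqP r1' r2'] max] := prevPP _ Hq'.
    move: (Hq') => /setIP[/setDP[Eq nKq] _]; case/negP: nKq.
    rewrite inE Eq; apply/existsP; exists (prev p'); apply/andP; split.
      rewrite /crosses Ep' r1 lt1 eq2' r2' andbT /=.
      by have := rangeE Eq'; rewrite r1'; lia.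
    by apply/forallP=> r; apply/implyP=> /max; rewrite eq2'.
  have [/and3P[_ _ ltp] maxp] := prevPP _ Hp.
  have [/and3P[_ _ ltq] maxq] := prevPP _ Hq.
  have eq1 : p.1 = q.1.
    apply/val_inj; case: (ltngtP (val p.1) (val q.1)) => // lt1.
      by case: (no_lt p q).
    by case: (no_lt q p).
  have [Ep Eq] : p \in E /\ q \in E.
    by move: Hp Hq => /setIP[/RE ? _] /setIP[/RE ? _].
  by have [//|/maxq|/maxp] := same_rowP eq1 Ep Eq; move: eq2 => /=; lia.
have [/and3P[Er _ lt] _] := prevPP _ Hp.
have [? ?] := rangeE Er; move: Hp => /setIP[/RE/rangeE[? ?] _] /=; lia.
Qed.

(* If [top_cross z'], for z' the preimage of the new last point, starts before
   the preimage p' of the old one, then by maximality of [top_cross p'] it ends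
   no earlier than p', so that p' itself can be inserted into the chain. *)
Lemma lift_chain p s : path below p s -> {subset p :: s <= shrink @: kept} ->
  exists q t, [/\ path below q t, {subset q :: t <= E}, size t = size s,
    q.2 = p.2 & (last q t).1 < (last p s).1 /\ (last q t).2 <= (last p s).2].
Proof.
elim/last_ind: s => [|s z IHs] ps sub.
  have /imsetP[p' Kp' ->] := sub p (mem_head _ _).
  have [/and4P[Et lt1 le2 lt2] _] := top_crossP Kp'.
  exists (top_cross p'), [::]; split => //=.
  by move=> x; rewrite inE => /eqP ->.
move: ps; rewrite rcons_path => /andP[ps].
have [|q [t [qt subt szt q2 [lt1 le2]]]] := IHs ps.
  by move=> x xs; apply: sub; rewrite -rcons_cons mem_rcons inE xs orbT.
have /imsetP[z' Kz' ->] : z \in shrink @: kept.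
  by apply: sub; rewrite -rcons_cons mem_rcons mem_head.
have /imsetP[p' Kp' def_p'] : last p s \in shrink @: kept.
  by apply: sub; rewrite -rcons_cons mem_rcons inE mem_last orbT.
rewrite def_p' /= in lt1 le2 *; case/andP=> /= ltz1 ltz2.
have [/and4P[Ez cz1 cz2 cz3] _] := top_crossP Kz'.
have [/and4P[_ _ _ cp3] max] := top_crossP Kp'.
suff [w [Ew ltw1 ltw2 w1 w2]] : exists w, [/\ w \in E, (last q t).1 < w.1,
    (last q t).2 < w.2, w.1 < z'.1 & w.2 <= (top_cross z').2].
  exists q, (rcons t w); rewrite rcons_path !last_rcons !size_rcons szt; split => //.
    by rewrite qt /below ltw1.
  move=> x; rewrite -rcons_cons mem_rcons inE => /predU1P[->//|]; exact: subt.
have [le_c|lt_c] := leqP p'.1 (top_cross z').1.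
  exists (top_cross z'); split => //; first exact: leq_trans lt1 le_c.
  exact: leq_ltn_trans le2 ltz2.
exists p'; split => //; first by move: Kp'; rewrite inE => /andP[].
  exact: leq_ltn_trans le2 cp3.
rewrite leqNgt; apply/negP => lt_p'.
have /max : crosses p' (top_cross z').
  by rewrite /crosses Ez lt_c lt_p' (leq_trans (ltnW ltz1) cz2).
by rewrite leqNgt ltz2.
Qed.

(** The lifted chain can be extended by the preimage [p'] of the last point, which has the same left
    end and a larger right end. The first right end is unchanged, so a common element remains. *)
Lemma shrink_chain_free k : chain_free k.+1 E -> chain_free k (shrink @: kept).
Proof.
move=> free p s ps sub le_last.
have [q [t [qt subt szt q2 [lt1 le2]]]] := lift_chain ps sub.
have /imsetP[p' Kp' def_p'] := sub _ (mem_last p s).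
have [/and4P[_ _ _ cp3] _] := top_crossP Kp'.
rewrite def_p' /= in lt1 le2 le_last.
have := free q (rcons t p'); rewrite rcons_path last_rcons size_rcons szt ltnS.
apply; last by rewrite q2.
  by rewrite qt /below; lia.
move=> x; rewrite -rcons_cons mem_rcons inE => /predU1P[->|]; last exact: subt.
by move: Kp'; rewrite inE => /andP[].
Qed.

End Peel.

Lemma card_chain_free k lo m E : chain_free k E ->
  {in E, forall p, lo <= p.1 <= p.2 /\ p.2 < lo + m} ->
  #|E| <= 'C(m.+1, 2) - 'C((m - 2 * k).+1, 2).
Proof.
elim: k lo m E => [|k IHk] lo m E free rangeE.
  (* For [k = 0] a single point is already a forbidden chain. *)
  rewrite (_ : E = set0) ?cards0 //; apply/setP=> p; rewrite inE; apply/negP=> Ep.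
  suff: size (Nil ('I_N * 'I_N)) < 0 by [].
  apply: (free p) => //=; last by have [/andP[]] := rangeE p Ep.
  by move=> q; rewrite inE => /eqP ->.
have := IHk lo.+1 (m - 2) _ (shrink_chain_free free) (shrink_range rangeE).
rewrite (card_in_imset (shrink_inj (E := E))) => leK.
have KE : kept E \subset E by apply/subsetP=> p; rewrite inE => /andP[].
have := card_removed rangeE; rewrite cardsD (setIidPr KE) => leR.
have := subset_leq_card KE.
rewrite (bin2_rec m); rewrite (_ : m - 2 * k.+1 = m - 2 - 2 * k); last by lia.
have : 'C((m - 2 - 2 * k).+1, 2) <= 'C((m - 2).+1, 2) by apply: leq_bin2l; lia.
lia.
Qed.

End Chains.

(** * Segments as points, and the upper bound for segments *)

Definition segment_of (n : nat) (p : 'I_n * 'I_n) := segment n p.1.+1 p.2.+1.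

Lemma mem_segment_of n (p : 'I_n * 'I_n) x : (x \in segment_of p) = (p.1 <= x <= p.2).
Proof. by rewrite inE. Qed.

Lemma segment_of_sub n (p q : 'I_n * 'I_n) : p.1 <= p.2 ->
  (segment_of p \subset segment_of q) = (q.1 <= p.1) && (p.2 <= q.2).
Proof.
move=> le_p; apply/subsetP/andP => [sub|[le1 le2] x].
  have := sub p.1; have := sub p.2; rewrite !mem_segment_of !leqnn le_p /=.
  by move=> /(_ isT) /andP[_ ->] /(_ isT) /andP[->].
by rewrite !mem_segment_of; lia.
Qed.

Lemma segment_of_inj n : {in [pred p : 'I_n * 'I_n | p.1 <= p.2] &, injective (@segment_of n)}.
Proof.
move=> [a b] [c d]; rewrite !inE /= => le_p le_q eq_pq.
have := @segment_of_sub n (a, b) (c, d) le_p.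
have := @segment_of_sub n (c, d) (a, b) le_q.
rewrite eq_pq subxx /= => /esym/andP[le1 le2] /esym/andP[le3 le4].
by congr (_, _); apply/val_inj/eqP; rewrite eqn_leq ?le1 ?le2 ?le3 ?le4.
Qed.

Lemma segment_of_surj n U x : U \in segments n -> x \in U ->
  exists2 p : 'I_n * 'I_n, p.1 <= p.2 & U = segment_of p.
Proof.
case/segmentsP=> i [j ->]; rewrite inE => /andP[le_i le_j].
have ltx := ltn_ord x.
(* The endpoints are clamped to [[n]]; [i = 0] and [i = 1] both give index [0]. *)
have lt1 : i.-1 < n by lia.
have lt2 : (minn j n).-1 < n by lia.
exists (Ordinal lt1, Ordinal lt2); first by rewrite /=; lia.
by apply/setP=> y; have := ltn_ord y; rewrite !inE /=; lia.
Qed.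

(** The left end of the last point lies in every segment of the chain, being at most the first,
    hence smallest, right end. *)
Lemma locally_wide_chain_free n k (F : {set {set 'I_n}}) : locally_wide k F ->
  chain_free k [set p : 'I_n * 'I_n | (p.1 <= p.2) && (segment_of p \in F)].
Proof.
move=> /forallP wF p s ps sub le_last.
have le_s q : q \in p :: s -> q.1 <= q.2 by move/sub; rewrite inE => /andP[].
have := forallP (wF (last p s).1) (@segment_of n @: [set q in p :: s]).
rewrite card_in_imset; last first.
  by move=> q r; rewrite ![_ \in finset _]inE => /le_s ? /le_s ?; apply: segment_of_inj.
rewrite cardsE (card_uniqP (path_below_uniq ps)) => /implyP; apply; apply/andP; split.
  apply/subsetP=> _ /imsetP[q + ->]; rewrite inE => qs.
  have [le1 le2 le3] := path_below_last ps qs.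
  move: (sub q qs); rewrite !inE => /andP[_ ->] /=; lia.
apply/forall_inP=> _ /imsetP[q + ->]; rewrite inE => qs.
apply/forall_inP=> _ /imsetP[r + ->]; rewrite inE => rs.
rewrite segment_of_sub ?le_s //; apply/implyP=> /andP[le1 le2].
by rewrite (path_below_antichain ps qs rs).
Qed.

Lemma card_locally_wide n k (F : {set {set 'I_n}}) :
  F \subset segments n -> locally_wide k F ->
  #|F| <= 1 + ('C(n.+1, 2) - 'C((n - 2 * k).+1, 2)).
Proof.
(* The summand 1 accounts for the empty segment. *)
move=> /subsetP sF wF; rewrite (cardsD1 set0); apply: leq_add; first by case: (_ \in _).
apply: leq_trans (card_chain_free (lo := 0) (locally_wide_chain_free wF) _); last first.
  by move=> p; rewrite inE => /andP[le_p _]; rewrite add0n ltn_ord.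
apply: leq_trans (leq_imset_card (@segment_of n) _); apply/subset_leq_card/subsetP=> U.
case/setD1P=> /set0Pn[x Ux] FU; have [p le_p defU] := segment_of_surj (sF U FU) Ux.
by apply/imsetP; exists p; rewrite // inE le_p -defU.
Qed.

(** * Lower bound: the extremal family *)

Definition long_pairs (n c : nat) : {set 'I_n * 'I_n} :=
  [set p : 'I_n * 'I_n | (c <= p.1) && (p.1 + c <= p.2)].

Lemma sum_succ_sub n c : \sum_(b < n) (b.+1 - c) = 'C((n - c).+1, 2).
Proof.
elim: n => [|n IHn]; first by rewrite big_ord0.
rewrite big_ord_recr /= IHn; have [le_cn|lt_nc] := leqP c n.
  by rewrite !subSn // (binS _.+1) bin1.
by have [-> ->] : n.+1 - c = 0 /\ n - c = 0 by lia.
Qed.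

(** For a fixed right end [b], the left ends fill [c <= a < b.+1 - c], leaving [b.+1 - 2 * c]
    choices. *)
Lemma card_long_pairs n c : #|long_pairs n c| = 'C((n - 2 * c).+1, 2).
Proof.
rewrite -sum_succ_sub -sum1_card.
rewrite (eq_bigl (fun p : 'I_n * 'I_n => true && ((c <= p.1) && (p.1 + c <= p.2)))); last first.
  by move=> p; rewrite inE.
rewrite -(pair_big_dep xpredT (fun a b : 'I_n => (c <= a) && (a + c <= b)) (fun _ _ => 1)) /=.
rewrite (exchange_big_dep xpredT) //=; apply: eq_bigr => b _.
rewrite (eq_bigl (fun a : 'I_n => (a < b.+1 - c) && (c <= a))); last by move=> a; lia.
rewrite -(big_geq_mkord _ _ (fun a => a < b.+1 - c) (fun _ => 1)) /=.
rewrite -(big_nat_widen _ _ _ xpredT) ?sum_nat_const_nat ?muln1; last first.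
  by have := ltn_ord b; lia.
by lia.
Qed.

Lemma card_antichain_through n (A : {set 'I_n * 'I_n}) (x : nat) (p : 'I_n * 'I_n) :
  {in A, forall q : 'I_n * 'I_n, q.1 <= x <= q.2} ->
  {in A &, forall q r : 'I_n * 'I_n, r.1 <= q.1 -> q.2 <= r.2 -> q = r} ->
  p \in A -> #|A| <= p.2.+1 - p.1.
Proof.
move=> thr anti Ap.
have cmp q r : q \in A -> r \in A -> (q.1 < r.1) = (q.2 < r.2).
  move=> Aq Ar; apply/idP/idP => lt; rewrite ltnNge; apply/negP => le.
    by move: (lt); rewrite (anti r q Ar Aq (ltnW lt) le) ltnn.
  by move: (lt); rewrite (anti q r Aq Ar le (ltnW lt)) ltnn.
(* The values [q.2.+1] exceed [x] and the values [q.1] do not, so the two kinds never collide. All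
   lie in [p], since [q.1 < p.1] forces [q.2 < p.2]. *)
pose f (q : 'I_n * 'I_n) : nat := if q.1 < p.1 then q.2.+1 else q.1.
apply: (@leq_card_interval _ _ f p.1) => [[a b] [c d] Aq Ar|[a b] Aq]; rewrite /f /=.
  have eqA : a = c :> nat \/ b = d :> nat -> (a, b) = (c, d).
    have c1 := cmp _ _ Aq Ar; have c2 := cmp _ _ Ar Aq; rewrite /= in c1 c2.
    by case=> e; apply: (anti _ _ Aq Ar) => /=; lia.
  have := thr _ Aq; have := thr _ Ar => /=.
  by case: ifP => _; case: ifP => _ ? ? e; apply: eqA; lia.
have := thr _ Aq; have := thr p Ap; have := cmp _ p Aq Ap => /=; case: ifP; lia.
Qed.

Definition wide_family (k n : nat) : {set {set 'I_n}} :=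
  set0 |: @segment_of n @: (long_pairs n 0 :\: long_pairs n k).

Lemma wide_family_segments k n : wide_family k n \subset segments n.
Proof.
apply/subsetP=> U /setU1P[->|/imsetP[p _ ->]]; apply/segmentsP; last by exists p.1.+1, p.2.+1.
by exists 1, 0; apply/setP=> x; rewrite !inE.
Qed.

Lemma card_wide_family k n :
  #|wide_family k n| = 1 + ('C(n.+1, 2) - 'C((n - 2 * k).+1, 2)).
Proof.
rewrite cardsU1 card_in_imset; last first.
  move=> p q /setDP[+ _] /setDP[+ _]; rewrite !inE !addn0 /= => ? ?.
  exact: segment_of_inj.
rewrite cardsDS; last by apply/subsetP=> p; rewrite !inE; lia.
rewrite !card_long_pairs muln0 subn0; congr (_ + _).
case: imsetP => //= -[p /setDP[+ _] /setP/(_ p.1)].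
by rewrite mem_segment_of !inE addn0 leqnn /= => ->.
Qed.

Lemma wide_family_wide k n : locally_wide k (wide_family k n).
Proof.
apply/forallP=> x; apply/forallP=> A; apply/implyP=> /andP[/subsetP sA antiA].
pose B := [set p in long_pairs n 0 :\: long_pairs n k | segment_of p \in A].
have leB p : p \in B -> p.1 <= p.2.
  by rewrite inE => /andP[/setDP[+ _] _]; rewrite inE addn0.
have -> : A = @segment_of n @: B.
  apply/setP=> U; apply/idP/imsetP=> [AU|[p + ->]]; last by rewrite inE => /andP[].
  have := sA U AU; rewrite inE => /andP[/setU1P[->|/imsetP[p Dp defU] _]].
    by rewrite inE.
  by exists p; rewrite // inE Dp -defU.
apply: leq_trans (leq_imset_card _ _) _.
have thr : {in B, forall p : 'I_n * 'I_n, p.1 <= x <= p.2}.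
  move=> p; rewrite inE => /andP[_ /sA].
  by rewrite [_ \in [set U in _ | _]]inE mem_segment_of => /andP[].
have anti : {in B &, forall q r : 'I_n * 'I_n, r.1 <= q.1 -> q.2 <= r.2 -> q = r}.
  move=> q r Bq Br le1 le2; apply: segment_of_inj; rewrite ?inE ?leB //.
  move: (Bq) (Br); rewrite !inE => /andP[_ Aq] /andP[_ Ar].
  apply/eqP; have /implyP := forall_inP (forall_inP antiA _ Aq) _ Ar; apply.
  by rewrite segment_of_sub ?leB ?le1.
(* A member with [k <= p.1] has at most [k] elements, which bounds the antichain. If there is none,
   the left ends are distinct and below [k]. *)
have [/existsP[p /andP[Bp le_kp]]|/existsPn small] := boolP [exists p in B, k <= p.1].
  apply: leq_trans (card_antichain_through thr anti Bp) _.
  by move: Bp; rewrite !inE le_kp /=; lia.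
apply: (@leq_card_interval _ _ (fun p : 'I_n * 'I_n => p.1) 0) => [p q Bp Bq eq1|p Bp].
  have [le2|lt2] := leqP p.2 q.2; first by apply: anti; rewrite // eq1.
  by apply/esym/anti; rewrite // ?eq1 // ltnW.
by have := small p; rewrite Bp -ltnNge.
Qed.

(** * Closed formula and recursion *)

Lemma max_wideE k n : max_wide k n = 1 + ('C(n.+1, 2) - 'C((n - 2 * k).+1, 2)).
Proof.
have [[F [sF wF cardF]] max] := max_wideP k n; apply/eqP.
rewrite eqn_leq -{1}cardF card_locally_wide //= -card_wide_family.
exact: max (wide_family_segments k n) (wide_family_wide k n).
Qed.

Theorem theorem3p6p6 :
  [/\ forall k : nat, max_wide k 0 = 1,
      forall n : nat, max_wide 0 n = 1,
      forall k : nat, 1 <= k -> max_wide k 1 = 2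
    & forall k n : nat, 1 <= k -> 2 <= n ->
        max_wide k n = 2 * n - 1 + max_wide (k - 1) (n - 2)].
Proof.
split=> [k|n|k k_gt0|k n k_gt0 _]; rewrite !max_wideE.
- by [].
- by rewrite muln0 subn0 subnn.
- by rewrite (_ : 1 - 2 * k = 0) //; lia.
(* Replacing [(k, n)] by [(k - 1, n - 2)] preserves [n - 2 * k], so only the first binomial
   changes. *)
rewrite (bin2_rec n) (_ : n - 2 * k = n - 2 - 2 * (k - 1)); last by lia.
have : 'C((n - 2 - 2 * (k - 1)).+1, 2) <= 'C((n - 2).+1, 2) by apply: leq_bin2l; lia.
lia.
Qed.
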